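(* Let $(X,d_X)$ and $(Y,d_Y)$ be metric spaces, $f:X\to Y$ a continuous function on $X$, $p\in X$ and $\epsilon>0$. Assume $f^{-1}(S[f(p),\epsilon])\neq\emptyset$, where $S[f(p),\epsilon]=\{y\in Y: d_Y(f(p),y)=\epsilon\}$. Then: 1. The quantity $\delta(p,\epsilon)=\mathrm{dist}(p,f^{-1}(S[f(p),\epsilon]))$ is well defined and is a positive number. Furthermore, if the open ball $B(p,\delta(p,\epsilon))$ is path-connected, then: 2. $\delta(p,\epsilon)$ is a delta-epsilon number for $f$ at $p$; that is, for every $x\in X$ with $d_X(x,p)<\delta(p,\epsilon)$ one has $d_Y(f(x),f(p))<\epsilon$. 3. $\delta(p,\epsilon)$ is the greatest delta-epsilon number for $f$ at $p$. 4. If $D_{p,\epsilon}=\{\beta\in\mathbb{R}^+ : (\forall x\in X)(d_X(x,p)<\beta\Rightarrow d_Y(f(x),f(p))<\epsilon)\}$, then $\delta(p,\epsilon)=\max D_{p,\epsilon}$ and $D_{p,\epsilon}=(0,\delta(p,\epsilon)]$.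
   Context: For a point $p\in X$ and a nonempty set $A\subset X$, $\mathrm{dist}(p,A)=\inf\{d_X(p,x): x\in A\}$. $B(p,r)=\{x\in X: d_X(x,p)<r\}$ is the open ball. $\mathbb{R}^+$ is the set of positive real numbers. Given $\epsilon>0$ and $f$ continuous at $p$, a positive number $\delta$ is called a delta-epsilon number for $f$ at $p$ (for the given $\epsilon$) if for all $x\in X$, $d_X(x,p)<\delta$ implies $d_Y(f(x),f(p))<\epsilon$. *)

(* Defs.v *)
From HB Require Import structures.
From mathcomp Require Import all_boot all_order all_algebra.
From mathcomp Require Import all_classical all_reals all_analysis.

Set Implicit Arguments.
Unset Strict Implicit.
Unset Printing Implicit Defensive.

Import Order.TTheory GRing.Theory Num.Theory.
Import numFieldNormedType.Exports.

Local Open Scope classical_set_scope.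
Local Open Scope ring_scope.

Section Metric.
Context {R : realType}.
Implicit Types X Y : metricType R.

(* [inf] is total, with value 0 on sets for which [has_inf] fails (such as the
   empty set), so that [has_inf] has to be asserted separately. *)
Definition dist_to_set X (p : X) (A : set X) : R :=
  inf [set mdist p x | x in A].

Definition msphere Y (c : Y) (r : R) : set Y := [set y | mdist c y = r].

Definition delta X Y (f : X -> Y) (p : X) (eps : R) : R :=
  dist_to_set p (f @^-1` msphere (f p) eps).

Definition is_delta_epsilon_number X Y (f : X -> Y) (p : X) (eps d : R) :
    Prop :=
  0 < d /\ forall x : X, mdist x p < d -> mdist (f x) (f p) < eps.

(* Paths are total functions on [R]; only their restriction to [0, 1], with
   the subspace topology, is constrained. *)
Definition path_connected (T : topologicalType) (A : set T) : Prop :=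
  forall x y : T, A x -> A y ->
  exists g : R -> T, [/\ {within `[0, 1], continuous g},
    g 0 = x, g 1 = y & g @` `[0, 1] `<=` A].

Definition is_max (D : set R) (m : R) : Prop := D m /\ ubound D m.

End Metric.

Arguments path_connected R {T} A.

(* Main.v *)
Require Import Defs.
From mathcomp Require Import all_boot all_order all_algebra.
From mathcomp Require Import all_classical all_reals all_analysis.

Import Order.TTheory GRing.Theory Num.Theory.
Import numFieldNormedType.Exports.

Local Open Scope classical_set_scope.
Local Open Scope ring_scope.

(** Write [delta] for the distance from [p] to the preimage of the sphere of
    radius [eps] about [f p].

    It is positive because, by continuity, [f] maps some ball [ball p r] into
    the open ball of radius [eps], so that no point of [ball p r] is sent to the
    sphere ([delta_gt0]).

    Suppose that [ball p delta] is path-connected and that one of its points [x]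
    satisfies [eps <= mdist (f p) (f x)]. Along a path from [p] to [x] inside
    the ball, the distance from [f p] to the image is a continuous real function
    that goes from [0] to a value at least [eps]; by the intermediate value
    theorem ([path_meets_sphere]) some point of the path is sent to the sphere,
    although it lies at distance less than [delta] from [p]: a contradiction.

    Finally, a number [b > delta] is not a delta-epsilon number, since some
    point at distance less than [b] from [p] is sent to the sphere, where the
    distance to [f p] is not less than [eps] ([delta_epsilon_number_le_delta]).
    Delta-epsilon numbers being closed under passing to smaller positive
    numbers, they form the interval from [0] (excluded) to [delta] (included). *)

Lemma ler_dist_mdist (R : realFieldType) (X : metricType R) (c x y : X) :
  `|mdist c x - mdist c y| <= mdist x y.
Proof.
rewrite ler_norml lerBrDr lerBlDr addrC lerBlDr.
by rewrite {2}(metric_sym x y) [in X in _ && X]addrC !metric_triangle.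
Qed.

Lemma mdist_continuous (R : realType) (X : metricType R) (c : X) :
  continuous (mdist c : X -> R).
Proof.
move=> x; apply/cvgrPdist_lt => e e0.
have := nbhsx_ballx x e e0; apply: filterS => y; rewrite ballEmdist /=.
exact/le_lt_trans/ler_dist_mdist.
Qed.

Section DistToSet.
Context {R : realType} {X : metricType R}.
Implicit Types (p x : X) (A : set X).

Lemma has_inf_mdist p A : A !=set0 -> has_inf [set mdist p x | x in A].
Proof.
move=> [a Aa]; split; first by exists (mdist p a), a.
by exists 0 => _ [x _ <-]; exact: mdist_ge0.
Qed.

Lemma dist_to_set_le p A x : A x -> dist_to_set p A <= mdist p x.
Proof.
move=> Ax; apply: ge_inf; last by exists x.
by case: (has_inf_mdist p A); first by exists x.
Qed.

End DistToSet.

Section Delta.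
Context {R : realType} {X Y : metricType R}.
Variables (f : X -> Y) (p : X) (eps : R).
Hypothesis hf : continuous f.
Hypothesis heps : 0 < eps.

Let S := f @^-1` msphere (f p) eps.

Lemma delta_gt0 : S !=set0 -> 0 < delta f p eps.
Proof.
move=> S0.
have /nbhs_ballP[r /= r0 rS] : nbhs p (f @^-1` ball (f p) eps).
  exact/hf/nbhsx_ballx.
apply: (lt_le_trans r0); apply: lb_le_inf; first by case: (has_inf_mdist p S S0).
move=> _ [x Sx <-]; rewrite leNgt; apply/negP => px.
have := rS x; rewrite !ballEmdist /= => /(_ px).
by rewrite Sx ltxx.
Qed.

(** A path starting at [p] and ending at a point whose image is at distance at
    least [eps] from [f p] passes through the preimage of the sphere. *)
Lemma path_meets_sphere (g : R -> X) :
    {within `[0, 1], continuous g} -> g 0 = p -> eps <= mdist (f p) (f (g 1)) ->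
  exists2 t, t \in `[0, 1] & S (g t).
Proof.
move=> cg g0 g1.
pose h := (mdist (f p) \o f) \o g.
have ch : {within `[0, 1], continuous h}.
  apply: within_continuous_comp cg => x _.
  by apply: continuous_comp; [exact: hf|exact: mdist_continuous].
have h0 : h 0 = 0 by rewrite /h /= g0 mdistxx.
apply: (IVT ler01 ch).
by rewrite h0 min_l ?mdist_ge0// max_r ?mdist_ge0// (ltW heps).
Qed.

Lemma delta_is_delta_epsilon_number : S !=set0 ->
  path_connected R (ball p (delta f p eps)) ->
  is_delta_epsilon_number f p eps (delta f p eps).
Proof.
move=> S0 pc; split; first exact: delta_gt0.
move=> x xp; rewrite metric_sym ltNge; apply/negP => fx.
have pB : ball p (delta f p eps) p by rewrite ballEmdist /= mdistxx delta_gt0.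
have xB : ball p (delta f p eps) x by rewrite ballEmdist /= metric_sym.
have [g [cg g0 g1 gB]] := pc _ _ pB xB.
have [|t t01 St] := path_meets_sphere g cg g0; first by rewrite g1.
have : ball p (delta f p eps) (g t) by apply: gB; exists t.
by rewrite ballEmdist /= ltNge dist_to_set_le.
Qed.

Lemma delta_epsilon_number_le_delta (b : R) : S !=set0 ->
  is_delta_epsilon_number f p eps b -> b <= delta f p eps.
Proof.
move=> S0 [_ hb]; apply: lb_le_inf; first by case: (has_inf_mdist p S S0).
move=> _ [x Sx <-]; rewrite leNgt metric_sym; apply/negP => /hb.
by rewrite metric_sym Sx ltxx.
Qed.

End Delta.

Theorem theorem1 (R : realType) (X Y : metricType R) (f : X -> Y)
    (hf : continuous f) (p : X) (eps : R) (heps : 0 < eps)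
    (hS : f @^-1` msphere (f p) eps !=set0) :
  (has_inf [set mdist p x | x in f @^-1` msphere (f p) eps] /\
   0 < delta f p eps) /\
  (path_connected R (ball p (delta f p eps)) ->
   [/\ is_delta_epsilon_number f p eps (delta f p eps),
       is_max [set d | is_delta_epsilon_number f p eps d] (delta f p eps)
     & let D := [set b : R | 0 < b /\
         forall x : X, mdist x p < b -> mdist (f x) (f p) < eps] in
       is_max D (delta f p eps) /\ D = [set` `]0, delta f p eps]]]).
Proof.
split; first by split; [exact: has_inf_mdist|exact: delta_gt0].
move=> pc; have dP := delta_is_delta_epsilon_number f p eps hf heps hS pc.
have maxP : is_max [set d | is_delta_epsilon_number f p eps d] (delta f p eps).
  by split=> // b; exact: delta_epsilon_number_le_delta.
split=> //; split=> //; apply/seteqP; split=> b /=.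
  by move=> bP; rewrite in_itv /= bP.1 (maxP.2 b bP).
rewrite in_itv /= => /andP[b0 bd]; split=> // x xb.
exact/dP.2/(lt_le_trans xb bd).
Qed.
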